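(* For every $f\in\mathcal{C}_{-\infty}(\mathbb{R}^n)$ and every $u\in\mathbb{S}^{n-1}$, we have $\widetilde{\tau}_uf=\tau_u^{-\infty}f$.
   Context: $\mathcal{C}_{-\infty}(\mathbb{R}^n)$ is the set of upper semicontinuous functions $f:\mathbb{R}^n\to[0,\infty)$, not identically zero, with $\lim_{|x|\to\infty}f(x)=0$, that are quasiconcave: $f(\lambda x+(1-\lambda)y)\ge\min\{f(x),f(y)\}$ for all $x,y\in\mathbb{R}^n$, $\lambda\in[0,1]$. $R_u(x)=x-2\langle x,u\rangle u$, and for $A\subset\mathbb{R}^n$, $\tau_uA=\frac12A+\frac12R_uA$ (Minkowski sum). The layer cake Minkowski symmetral is $$\widetilde{\tau}_uf(x)=\int_0^\infty\mathbf{1}_{\tau_u(\{f\ge t\})}(x)\,dt,$$ where $\mathbf{1}_A$ is the characteristic function of $A$. The $(-\infty)$-Minkowski symmetral is $$\tau_u^{-\infty}f(x)=\sup_{y+z=x}\min\{f(2y),f(R_u(2z))\}.$$ *)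

(* Defs.v *)
From HB Require Import structures.
From mathcomp Require Import all_boot all_order all_algebra.
From mathcomp Require Import all_classical all_reals all_analysis.

Set Implicit Arguments.
Unset Strict Implicit.
Unset Printing Implicit Defensive.

Import Order.TTheory GRing.Theory Num.Theory.
Import numFieldNormedType.Exports.

Local Open Scope classical_set_scope.
Local Open Scope ring_scope.

(* The canonical norm of 'rV[R]_n is the sup norm, hence the explicit Euclidean
   structure. The two norms induce the same topology, so neighbourhoods are
   those of the library. *)
Definition inner (R : realType) (n : nat) (x y : 'rV[R]_n) : R :=
  \sum_(i < n) x ord0 i * y ord0 i.

Definition enorm (R : realType) (n : nat) (x : 'rV[R]_n) : R :=
  Num.sqrt (inner x x).

Definition unit_sphere (R : realType) (n : nat) : set 'rV[R]_n :=
  [set u | enorm u = 1].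

(* Real-valued counterpart of the library's lower_semicontinuous. *)
Definition upper_semicontinuous (R : realType) (T : topologicalType)
    (f : T -> R) : Prop :=
  forall (x : T) (a : R), f x < a -> \forall y \near x, f y < a.

Definition vanishes_at_infinity (R : realType) (n : nat)
    (f : 'rV[R]_n -> R) : Prop :=
  forall e : R, 0 < e ->
    exists M : R, forall x : 'rV[R]_n, M < enorm x -> `|f x| < e.

Definition quasiconcave (R : realType) (n : nat) (f : 'rV[R]_n -> R) : Prop :=
  forall (x y : 'rV[R]_n) (l : R), 0 <= l <= 1 ->
    Num.min (f x) (f y) <= f (l *: x + (1 - l) *: y).

Definition C_minus_infty (R : realType) (n : nat) : set ('rV[R]_n -> R) :=
  [set f | [/\ forall x, 0 <= f x,
               exists x, f x != 0,
               upper_semicontinuous f,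
               vanishes_at_infinity f &
               quasiconcave f]].

Definition reflection (R : realType) (n : nat) (u x : 'rV[R]_n) : 'rV[R]_n :=
  x - (2 * inner x u) *: u.

Definition minkowski_add (R : realType) (n : nat) (A B : set 'rV[R]_n) :
    set 'rV[R]_n :=
  [set a + b | a in A & b in B].

Definition dilate (R : realType) (n : nat) (c : R) (A : set 'rV[R]_n) :
    set 'rV[R]_n :=
  [set c *: a | a in A].

Definition minkowski_symmetral (R : realType) (n : nat) (u : 'rV[R]_n)
    (A : set 'rV[R]_n) : set 'rV[R]_n :=
  minkowski_add (dilate 2^-1 A) (dilate 2^-1 (reflection u @` A)).

Definition superlevel (R : realType) (n : nat) (f : 'rV[R]_n -> R) (t : R) :
    set 'rV[R]_n :=
  [set x | t <= f x].

(* Both symmetrals of functions take values in \bar R, where the integral and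
   the supremum are always meaningful; no finiteness is presupposed. *)
Definition layer_cake_symmetral (R : realType) (n : nat) (u : 'rV[R]_n)
    (f : 'rV[R]_n -> R) (x : 'rV[R]_n) : \bar R :=
  (\int[lebesgue_measure]_(t in `[0%R, +oo[)
     (\1_(minkowski_symmetral u (superlevel f t)) x)%:E)%E.

Definition minus_infty_symmetral (R : realType) (n : nat) (u : 'rV[R]_n)
    (f : 'rV[R]_n -> R) (x : 'rV[R]_n) : \bar R :=
  ereal_sup [set (Num.min (f (2 *: p.1)) (f (reflection u (2 *: p.2))))%:E
            | p in [set p : 'rV[R]_n * 'rV[R]_n | p.1 + p.2 = x]].

(* Main.v *)
Require Import Defs.
From mathcomp Require Import all_boot all_order all_algebra.
From mathcomp Require Import all_classical all_reals all_analysis.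
From mathcomp Require Import measurable_realfun ring.

Set Implicit Arguments.
Unset Strict Implicit.
Unset Printing Implicit Defensive.

(** For fixed [x], the levels [t] with [x] in the Minkowski symmetral of
    [{f >= t}] are exactly those lying below some value
    [min (f (2 y)) (f (R_u (2 z)))] with [y + z = x], because [R_u] is an
    involution. The layer cake integral is thus the length of the nonnegative
    part of a down-closed set of reals, which is its supremum; whether the
    supremum is attained changes the set by one point only. *)

Import Order.TTheory GRing.Theory Num.Theory.
Import numFieldNormedType.Exports.

Local Open Scope classical_set_scope.
Local Open Scope ring_scope.

(** Every real strictly below the supremum [r] lies in the down-closure and none above it does, so
    its nonnegative part is squeezed between [[0, r)] and [[0, r]], both of length [r]. *)
Lemma integral_down_closure (R : realType) (S : set R) :
  S !=set0 -> (forall s, S s -> 0 <= s) ->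
  (\int[lebesgue_measure]_(t in `[0%R, +oo[)
     (\1_[set t : R | exists2 s, S s & t <= s] t)%:E)%E =
  ereal_sup [set s%:E | s in S].
Proof.
move=> [s0 Ss0] S_ge0; set E := [set t : R | _].
have mE : measurable E.
  apply: is_interval_measurable => x y _ [s Ss le_ys] z /andP[_ le_zy].
  by exists s => //; exact: le_trans le_ys.
have mD : measurable (`[0%R, +oo[ : set R) by exact: measurable_itv.
rewrite integral_indic//=.
have EP (t : R) : (t%:E < ereal_sup [set s%:E | s in S])%E -> E t.
  by move=> /ereal_sup_gt[_ [s Ss <-]]; rewrite lte_fin => /ltW; exists s.
have Esup (t : R) : E t -> (t%:E <= ereal_sup [set s%:E | s in S])%E.
  move=> [s Ss le_ts]; apply: (@le_trans _ _ s%:E); first by rewrite lee_fin.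
  by apply: ereal_sup_ubound; exists s.
have sup_ge0 : (0%:E <= ereal_sup [set s%:E | s in S])%E.
  by apply: Esup; exists s0 => //; exact: S_ge0.
(* Nonnegativity excludes the value [-oo]; for [+oo] the down-closure contains the whole half-line,
   of infinite measure. *)
case: (ereal_sup _) EP Esup sup_ge0 => [r| |//] EP Esup sup_ge0; last first.
  rewrite setIidr; first by rewrite lebesgue_measure_itv/= ltry.
  by move=> t _; apply: EP; rewrite ltry.
(* The boolean covers both right ends: [false] gives the closed interval, [true] the half-open one.
   If [r <= 0], then [r = 0]. *)
have muE b : lebesgue_measure [set` Interval (BLeft 0%R) (BSide b r)] = r%:E.
  rewrite lebesgue_measure_itv/= lte_fin; case: ltP => [_|r_le0].
    by rewrite sube0.
  by congr EFin; apply/le_anti; rewrite r_le0 andbT -lee_fin.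
have mED : measurable (E `&` [set` `[0%R, +oo[]) by exact: measurableI.
apply/le_anti/andP; split.
- rewrite -(muE false); apply: le_measure; rewrite ?inE//.
  by move=> t [/Esup]; rewrite /= !in_itv/= lee_fin andbT => -> ->.
- rewrite -[leLHS](muE true); apply: le_measure; rewrite ?inE//.
  move=> t; rewrite /= !in_itv/= => /andP[t_ge0 lt_tr].
  by split; [apply: EP; rewrite lte_fin | rewrite andbT].
Qed.

Section Reflection.
Variables (R : realType) (n : nat) (u : 'rV[R]_n).

Lemma innerBl (x y z : 'rV[R]_n) : inner (x - y) z = inner x z - inner y z.
Proof.
rewrite /inner -sumrB; apply: eq_bigr => i _.
by rewrite !mxE mulrBl.
Qed.

Lemma innerZl (c : R) (x z : 'rV[R]_n) : inner (c *: x) z = c * inner x z.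
Proof.
rewrite /inner mulr_sumr; apply: eq_bigr => i _.
by rewrite !mxE mulrA.
Qed.

Lemma unit_sphere_inner : unit_sphere u -> inner u u = 1.
Proof.
rewrite /unit_sphere /enorm /= => u1; rewrite -[LHS]sqr_sqrtr.
  by rewrite u1 expr1n.
by apply: sumr_ge0 => i _; rewrite -expr2 sqr_ge0.
Qed.

Lemma reflectionK : unit_sphere u -> involutive (reflection u).
Proof.
move=> /unit_sphere_inner u1 x.
(* With [c = 2 * inner x u], the multiples of [u] subtracted from [x] total
   [c + 2 * (inner x u - c) = 0]. *)
rewrite {1}/reflection innerBl innerZl u1 /reflection -addrA -opprD -scalerDl.
by rewrite [X in X *: u](_ : _ = 0) ?scale0r ?subr0//; ring.
Qed.

Lemma minkowski_symmetral_superlevelP (f : 'rV[R]_n -> R) (t : R) x :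
  unit_sphere u ->
  minkowski_symmetral u (superlevel f t) x <->
  exists2 p : 'rV[R]_n * 'rV[R]_n, p.1 + p.2 = x &
    t <= Num.min (f (2 *: p.1)) (f (reflection u (2 *: p.2))).
Proof.
move=> u1; have two_neq0 : (2 : R) != 0 by rewrite pnatr_eq0.
split.
- move=> [_ [a fa <-] [_ [_ [b fb <-] <-] <-]].
  (* Doubling the second component and reflecting it again gives back [b]. *)
  exists (2^-1 *: a, 2^-1 *: reflection u b) => //=.
  by rewrite !scalerA mulfV// !scale1r reflectionK// le_min fa.
- move=> [[y z] /= <-]; rewrite le_min => /andP[fy fz].
  exists y; first by exists (2 *: y); rewrite // scalerA mulVf// scale1r.
  exists z => //; exists (2 *: z); last by rewrite scalerA mulVf// scale1r.
  by exists (reflection u (2 *: z)); rewrite ?reflectionK.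
Qed.

End Reflection.

Theorem corollary3p6 (R : realType) (n : nat) (f : 'rV[R]_n -> R)
    (u : 'rV[R]_n) (hf : C_minus_infty f) (hu : unit_sphere u) :
  layer_cake_symmetral u f = minus_infty_symmetral u f.
Proof.
have [f_ge0 _ _ _ _] := hf; apply/funext => x.
pose m (p : 'rV[R]_n * 'rV[R]_n) :=
  Num.min (f (2 *: p.1)) (f (reflection u (2 *: p.2))).
pose S := [set m p | p in [set p | p.1 + p.2 = x]].
(* Any splitting of [x] would do; [x + 0] is the simplest. *)
have S_neq0 : S !=set0 by exists (m (x, 0)), (x, 0); rewrite //= addr0.
have S_ge0 s : S s -> 0 <= s by move=> [p _ <-]; rewrite le_min !f_ge0.
transitivity (ereal_sup [set s%:E | s in S]).
  rewrite -integral_down_closure//; apply: eq_integral => t _.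
  congr (_%:E); rewrite !indicE; congr ((_ : bool)%:R).
  apply/idP/idP; rewrite !inE.
    move=> /(minkowski_symmetral_superlevelP _ _ _ hu)[p px tp].
    by exists (m p) => //; exists p.
  move=> [_ [p px <-] tp].
  by apply/(minkowski_symmetral_superlevelP _ _ _ hu); exists p.
by rewrite /minus_infty_symmetral image_comp.
Qed.
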